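(* Let $\rho,\sigma\in\mathbb{C}^{d\times d}$ be two unknown quantum states, both accessible via samples, and let $\varepsilon\in(0,1)$. Then, using non-adaptive single-copy measurements, $\widetilde{\Omega}(1/\varepsilon^2)$ samples of $\rho$ and $\sigma$ are in general necessary, even for qubits ($d=2$), to decide with probability at least $0.99$ whether $\rho=\sigma$ or $F(\rho,\sigma)\le 1-\varepsilon$.
   Context: A quantum state in $\mathbb{C}^{d\times d}$ is a positive semidefinite matrix of trace one. Fidelity: $F(\rho,\sigma):=\|\sqrt{\rho}\sqrt{\sigma}\|_1$ (trace norm). A POVM is a (possibly continuous) family of positive operators $\{M_z\}$ summing to the identity; measuring $\rho$ yields outcome $z$ with probability $\operatorname{tr}[\rho M_z]$. Single-copy measurements: each copy is measured individually with a POVM; non-adaptive: all POVMs are fixed in advance (possibly chosen at random), independently of measurement outcomes. ''Deciding'' means: the algorithm outputs the correct alternative with the stated probability whenever one of the two alternatives holds; otherwise any output is allowed. $\widetilde\Omega$ hides polylogarithmic factors in the parameters (here in $1/\varepsilon$). *)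

(* Defs.v *)
From HB Require Import structures.
From mathcomp Require Import all_boot all_order all_algebra.
From mathcomp Require Import spectral complex.
From mathcomp Require Import all_classical all_reals all_analysis.
From mathcomp Require Import measurable_realfun.

Set Implicit Arguments.
Unset Strict Implicit.
Unset Printing Implicit Defensive.

Import Order.TTheory GRing.Theory Num.Theory.
Import numFieldNormedType.Exports.

Local Open Scope classical_set_scope.
Local Open Scope ring_scope.
Local Open Scope complex_scope.
Local Open Scope sesquilinear_scope.

Section Matrices.
Context {C : numClosedFieldType} {d : nat}.
Implicit Types (A B X : 'M[C]_d) (v : 'rV[C]_d).

Definition quad_form A v : C := (v *m A *m v ^t*) 0 0.

(* In a numClosedFieldType, 0 <= x means that x is real and nonnegative. *)
Definition psdmx A : Prop :=
  (A \is hermsymmx) /\ forall v, 0 <= quad_form A v.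

(* A = P^-1 *m diag D *m P, with P unitary, holds for normal A; mxsqrt is the
   usual square root on positive semidefinite matrices, and is used there
   only. *)
Definition mxsqrt A : 'M[C]_d :=
  invmx (spectralmx A) *m diag_mx (map_mx sqrtC (spectral_diag A))
  *m spectralmx A.

Definition trace_norm X : C := \tr (mxsqrt (X ^t* *m X)).

Definition fidelity A B : C := trace_norm (mxsqrt A *m mxsqrt B).

Lemma quad_form_row A B i : quad_form A (row i B) = (B *m A *m B ^t*) i i.
Proof.
rewrite /quad_form -row_mul !mxE.
by apply: eq_bigr => j _; rewrite !mxE.
Qed.

Lemma mxtrace_spectral A B : A \is hermsymmx ->
  \tr (A *m B) =
  \sum_i spectral_diag A 0 i * quad_form B (row i (spectralmx A)).
Proof.
move=> /hermitian_normalmx /orthomx_spectralP {1}->.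
set P := spectralmx A; have PU : P \is unitarymx := spectral_unitarymx A.
rewrite -!mulmxA mxtrace_mulC (invmx_unitary PU) -!mulmxA /mxtrace.
by apply: eq_bigr => i _; rewrite mul_diag_mx mxE quad_form_row mulmxA.
Qed.

Lemma spectral_diag_ge0 A i : psdmx A -> 0 <= spectral_diag A 0 i.
Proof.
move=> [/hermitian_normalmx /orthomx_spectralP AE A0].
set P := spectralmx A; have PU : P \is unitarymx := spectral_unitarymx A.
suff -> : spectral_diag A 0 i = quad_form A (row i P) by exact: A0.
rewrite quad_form_row [in RHS]AE -/P (invmx_unitary PU) !mulmxA.
by rewrite (unitarymxP PU) mul1mx mulmxtVK // mxE eqxx mulr1n.
Qed.

End Matrices.

Section States.
Context (R : realType) (d : nat).

Record state := State {
  state_mx :> 'M[R[i]]_d;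
  state_psd : psdmx state_mx;
  state_tr1 : \tr state_mx = 1 }.

End States.

Section POVM.
Context (R : realType) (d : nat) (disp : measure_display)
  (Z : measurableType disp).

(* A POVM with outcomes in an arbitrary measurable space Z: countable additivity
   is that of each scalar function S |-> <v| E(S) |v>.  As for the measures of the
   library, E is total and its values on nonmeasurable sets are irrelevant. *)
Record povm := Povm {
  povm_op :> set Z -> 'M[R[i]]_d;
  povm_psd : forall S, psdmx (povm_op S);
  povm_set0 : povm_op set0 = 0;
  povm_setT : povm_op setT = 1%:M;
  povm_sigma_additive : forall v : 'rV[R[i]]_d,
    semi_sigma_additive
      (fun S => (complex.Re (quad_form (povm_op S) v))%:E) }.

Definition outcome_law (E : povm) (rho : state R d) (S : set Z) : \bar R :=
  (complex.Re (\tr (rho *m E S)))%:E.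

Section OutcomeLaw.
Variables (E : povm) (rho : state R d).

Let outcome_lawE S : outcome_law E rho S = (\sum_i
  (complex.Re (spectral_diag rho 0 i))%:E *
  (complex.Re (quad_form (E S) (row i (spectralmx rho))))%:E)%E.
Proof.
have [rhoH _] := state_psd rho.
rewrite /outcome_law mxtrace_spectral // raddf_sum -sumEFin.
apply: eq_bigr => i _; rewrite -EFinM; congr EFin.
have := spectral_diag_ge0 i (state_psd rho).
case: (spectral_diag rho 0 i) => a b; rewrite lecE /= => /andP[/eqP -> _].
by case: (quad_form _ _) => x y /=; rewrite mul0r subr0.
Qed.

Let Re_ge0 (z : R[i]) : 0 <= z -> 0 <= complex.Re z.
Proof. by rewrite lecE => /andP[]. Qed.

Let outcome_law0 : outcome_law E rho set0 = 0%E.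
Proof. by rewrite /outcome_law povm_set0 mulmx0 mxtrace0. Qed.

Let outcome_law_term_ge0 S i : (0 <=
  (complex.Re (spectral_diag rho 0 i))%:E *
  (complex.Re (quad_form (E S) (row i (spectralmx rho))))%:E)%E.
Proof.
rewrite -EFinM lee_fin mulr_ge0 // Re_ge0 //.
  exact: spectral_diag_ge0 (state_psd rho).
by have [_] := povm_psd E S.
Qed.

Let outcome_law_ge0 S : (0 <= outcome_law E rho S)%E.
Proof. by rewrite outcome_lawE sume_ge0. Qed.

Let outcome_law_sigma_additive : semi_sigma_additive (outcome_law E rho).
Proof.
move=> F mF tF mUF; rewrite outcome_lawE.
rewrite [X in X @ _](_ : _ = fun n => (\sum_i
    (complex.Re (spectral_diag rho 0 i))%:E * \sum_(0 <= k < n)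
    (complex.Re (quad_form (E (F k)) (row i (spectralmx rho))))%:E)%E).
  apply: cvg_nnesum => i _; last first.
    by apply: cvgeZl => //; exact: povm_sigma_additive.
  apply: nearW => n; rewrite mule_ge0 ?sume_ge0 // => [|k _]; rewrite lee_fin.
    by rewrite Re_ge0 //; exact: spectral_diag_ge0 (state_psd rho).
  by rewrite Re_ge0 //; have [_] := povm_psd E (F k).
apply/funext => n; under eq_bigr do rewrite outcome_lawE.
rewrite exchange_big /=; apply: eq_bigr => i _.
rewrite ge0_sume_distrr // => k _; rewrite lee_fin.
by rewrite Re_ge0 //; have [_] := povm_psd E (F k).
Qed.

HB.instance Definition _ := isMeasure.Build _ _ _ (outcome_law E rho)
  outcome_law0 outcome_law_ge0 outcome_law_sigma_additive.

Let outcome_law_setT : outcome_law E rho setT = 1%E.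
Proof. by rewrite /outcome_law povm_setT mulmx1 state_tr1. Qed.

HB.instance Definition _ := Measure_isProbability.Build _ _ _
  (outcome_law E rho) outcome_law_setT.

End OutcomeLaw.

Definition outcome_probability (E : povm) (rho : state R d) :
  probability Z R := outcome_law E rho.

End POVM.

Section ProductLaws.
Context (R : realType) (disp : measure_display) (Z : measurableType disp).

Definition cons_pair n (x : Z * n.-tuple Z) : n.+1.-tuple Z :=
  [tuple of x.1 :: x.2].

Let measurable_cons_pair n : measurable_fun setT (@cons_pair n).
Proof. exact: measurable_cons. Qed.

HB.instance Definition _ n := isMeasurableFun.Build _ _ _ _ (@cons_pair n)
  (@measurable_cons_pair n).

(* The law of a tuple of independent outcomes with marginals P i. *)
Fixpoint tuple_probability n : ('I_n -> probability Z R) ->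
    probability (n.-tuple Z) R :=
  match n with
  | 0 => fun=> \d_[tuple]
  | n'.+1 => fun P => distribution
      (P ord0 \x tuple_probability (fun i => P (lift ord0 i)))%E
      (@cons_pair n')
  end.

End ProductLaws.

Section Algorithms.
Context (R : realType) (d : nat).

(* Copy i of rho is measured with strategy_rho i, copy j of sigma with
   strategy_sigma j; no POVM depends on an outcome.  A common outcome space
   loses no generality.  The answer true stands for "rho = sigma". *)
Record strategy (n m : nat) := Strategy {
  strategy_display : measure_display;
  outcome : measurableType strategy_display;
  strategy_rho : 'I_n -> povm R d outcome;
  strategy_sigma : 'I_m -> povm R d outcome;
  answer : n.-tuple outcome * m.-tuple outcome -> bool;
  measurable_answer : measurable_fun setT answer }.

Definition strategy_law n m (s : strategy n m) (rho sigma : state R d) :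
    probability (n.-tuple (outcome s) * m.-tuple (outcome s))%type R :=
  (tuple_probability (fun i => outcome_probability (strategy_rho s i) rho) \x
   tuple_probability
     (fun j => outcome_probability (strategy_sigma s j) sigma))%E.

Definition strategy_answers n m (s : strategy n m) (rho sigma : state R d)
    (b : bool) : \bar R :=
  strategy_law s rho sigma [set z | answer z = b].

(* The POVMs, and the classical post-processing, may be drawn at random before
   any measurement is made. *)
Record algorithm (n m : nat) := Algorithm {
  seed_display : measure_display;
  seed : measurableType seed_display;
  seed_law : probability seed R;
  seed_strategy : seed -> strategy n m;
  measurable_seed_strategy : forall (rho sigma : state R d) (b : bool),
    measurable_fun setT
      (fun w => strategy_answers (seed_strategy w) rho sigma b) }.

Definition algorithm_answers n m (a : algorithm n m) (rho sigma : state R d)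
    (b : bool) : \bar R :=
  \int[seed_law a]_w strategy_answers (seed_strategy w) rho sigma b.

(* The comparison takes place in R[i], where x <= y entails that y - x is real;
   the fidelity of two states is real. *)
Definition decides n m (a : algorithm n m) (eps : R) : Prop :=
  forall rho sigma : state R d,
    (rho = sigma :> 'M[R[i]]_d ->
       ((99%:R / 100%:R)%:E <= algorithm_answers a rho sigma true)%E) /\
    (fidelity rho sigma <= (1 - eps)%:C ->
       ((99%:R / 100%:R)%:E <= algorithm_answers a rho sigma false)%E).

End Algorithms.

(* Main.v *)
Require Import Defs.
From HB Require Import structures.
From mathcomp Require Import all_boot all_order all_algebra.
From mathcomp Require Import spectral complex.
From mathcomp Require Import all_classical all_reals all_analysis.
From mathcomp Require Import measurable_realfun.
From mathcomp Require Import ring lra.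

(* The hard instance hides a pure qubit state psi_z, z = x + iy, on a fine
   lattice of size N^2 >= 1/eps in the square [0, 1/2]^2, and compares (psi_z, psi_z) with
   (rho_z, psi_z), where rho_z = (1 - eta) psi_z + eta psi_z^perp and
   eta = 1 - (1 - eps)^2, so that the fidelity is exactly 1 - eps.  A rank-one
   effect |phi><phi| separates psi_z from rho_z with chi-square divergence of
   order eta^2 / (u + eta), where u = |<phi, psi_z>|^2, which is large only when
   phi is nearly orthogonal to psi_z.  As the POVM cannot depend on z,
   averaging over the two-dimensional lattice costs only logarithms: u is
   bounded below by the squared distance of z to a point depending on phi, and
     1 + s^2 + t^2 >= (1 + |s|) (1 + |t|) / 2
   turns the lattice sum into a product of two harmonic sums, whence an average
   divergence O(eps^2 log^2 (1/eps)) per copy.  Divergences of independent copies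
   multiply as 1 + chi^2, and a bounded divergence forbids reliable testing.
   By symmetry the same holds with (psi_z, rho_z). *)

Set Implicit Arguments.
Unset Strict Implicit.
Unset Printing Implicit Defensive.

Import Order.TTheory GRing.Theory Num.Theory.
Import numFieldNormedType.Exports.
Import HBSimple HBNNSimple.

Local Open Scope classical_set_scope.
Local Open Scope ring_scope.
Local Open Scope complex_scope.
Local Open Scope sesquilinear_scope.

(** * Chi-square divergence *)

Section Chi2.
Context (R : realType).
Local Open Scope ereal_scope.

(* By Cauchy-Schwarz the best B is 1 + chi^2(P || Q); this form needs no density
   and tensorizes by Fubini. *)
Definition chi2_bound d (T : measurableType d) (P Q : probability T R) (B : R) :=
  forall f : T -> \bar R, measurable_fun setT f -> (forall x, 0 <= f x) ->
    (\int[P]_x f x) * (\int[P]_x f x) <= B%:E * \int[Q]_x (f x * f x).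

Lemma chi2_bound_prod d1 d2 (T1 : measurableType d1) (T2 : measurableType d2)
    (P1 Q1 : probability T1 R) (P2 Q2 : probability T2 R) B1 B2 :
  (0 <= B1)%R -> (0 <= B2)%R ->
  chi2_bound P1 Q1 B1 -> chi2_bound P2 Q2 B2 ->
  chi2_bound (P1 \x P2) (Q1 \x Q2) (B1 * B2)%R.
Proof.
move=> B1ge0 B2ge0 h1 h2 f mf f0.
have mf2 : measurable_fun setT (fun x => f x * f x) by exact: emeasurable_funM.
have f20 x : 0 <= f x * f x by exact: mule_ge0.
have mF : measurable_fun setT (fubini_F P2 f).
  exact: measurable_fun_fubini_tonelli_F.
have mF2 : measurable_fun setT (fubini_F Q2 (fun x => f x * f x)).
  exact: measurable_fun_fubini_tonelli_F.
rewrite fubini_tonelli1 // (fubini_tonelli1 _ mf2) //.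
apply: (le_trans (h1 _ mF _)) => [x|]; first exact: integral_ge0.
rewrite EFinM -muleA; apply: lee_wpmul2l => //.
rewrite -ge0_integralZl //; last by move=> x _; apply: integral_ge0.
apply: ge0_le_integral => //.
- by move=> x _; apply: mule_ge0; exact: integral_ge0.
- exact: emeasurable_funM.
- exact: emeasurable_funM.
by move=> x _; apply: h2 => //; exact: measurableT_comp.
Qed.

Lemma chi2_bound_distribution d1 d2 (T1 : measurableType d1)
    (T2 : measurableType d2) (P Q : probability T1 R) (X : {mfun T1 >-> T2}) B :
  chi2_bound P Q B -> chi2_bound (distribution P X) (distribution Q X) B.
Proof.
move=> h f mf f0.
rewrite !ge0_integral_distribution //; last 2 first.
- exact: emeasurable_funM.
- by move=> x; exact: mule_ge0.
by apply: h => [|x]; [exact: measurableT_comp|exact: f0].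
Qed.

Lemma integral_nnsfun_fin_num d (T : measurableType d) (P : probability T R)
    (h : {nnsfun T >-> R}) : \int[P]_x (h x)%:E \is a fin_num.
Proof.
apply: integrable_fin_num => //; apply: measurable_bounded_integrable => //.
  by rewrite (le_lt_trans (probability_le1 _ _)) // ltry.
exact: simple_bounded.
Qed.

(** The hypothesis is a linearized form of the bound. Replacing [h] by [t h] and optimizing over
    [t >= 0] recovers the quadratic inequality for simple functions, and the integral of [f] is the
    supremum over the simple functions below [f]. *)
Lemma chi2_boundE d (T : measurableType d) (P Q : probability T R) (B : R) :
  (forall h : {nnsfun T >-> R},
    2%:E * (\int[P]_x (h x)%:E) <= B%:E + \int[Q]_x (h x * h x)%:E) ->
  chi2_bound P Q B.
Proof.
move=> H f mf f0.
set I := \int[Q]_x _.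
have I0 : 0 <= I by apply: integral_ge0 => x _; exact: mule_ge0.
have B0 : (0 <= B)%R.
  have := H nnsfun0.
  rewrite (eq_integral (cst 0)) // integral0 mule0.
  rewrite (eq_integral (cst 0)) => [|x _]; last by rewrite /= mulr0.
  by rewrite integral0 adde0 lee_fin.
have sq (h : {nnsfun T >-> R}) : (forall x, (h x)%:E <= f x) ->
    (\int[P]_x (h x)%:E) * (\int[P]_x (h x)%:E) <= B%:E * I.
  move=> hf.
  apply: (@le_trans _ _ (B%:E * \int[Q]_x (h x * h x)%:E)); last first.
    apply: lee_wpmul2l => //; apply: ge0_le_integral => //.
    - by move=> x _; rewrite lee_fin mulr_ge0.
    - by apply/measurable_EFinP; exact: measurable_funM.
    - exact: emeasurable_funM.
    by move=> x _; rewrite EFinM; apply: lee_pmul => //; rewrite lee_fin.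
  have Px := integral_nnsfun_fin_num P h.
  have Qy := integral_nnsfun_fin_num Q (mul_nnsfun h h).
  have Ht (t : R) (t0 : (0 <= t)%R) : 2%:E * (t%:E * \int[P]_x (h x)%:E) <=
      B%:E + t%:E * t%:E * \int[Q]_x (h x * h x)%:E.
    have -> : t%:E * \int[P]_x (h x)%:E = \int[P]_x (scale_nnsfun h t0 x)%:E.
      rewrite -ge0_integralZl //; last 2 first.
      - by apply: measurableT_comp.
      - by move=> x _; rewrite lee_fin.
    have -> : t%:E * t%:E * \int[Q]_x (h x * h x)%:E =
        \int[Q]_x (scale_nnsfun h t0 x * scale_nnsfun h t0 x)%:E.
      rewrite -ge0_integralZl //; last 3 first.
      - by apply/measurable_EFinP; exact: measurable_funM.
      - by move=> x _; rewrite lee_fin mulr_ge0.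
      - by rewrite mule_ge0 ?lee_fin.
      apply: eq_integral => x _; rewrite -!EFinM.
      by congr (_%:E); rewrite /=; ring.
    exact: H.
  have x0 : 0 <= \int[P]_x (h x)%:E by apply: integral_ge0 => x _; rewrite lee_fin.
  have y0 : 0 <= \int[Q]_x (h x * h x)%:E.
    by apply: integral_ge0 => x _; rewrite lee_fin mulr_ge0.
  move: Px x0 Qy y0 Ht => /=.
  case: (\int[P]_x _) => // x _; rewrite lee_fin => x0.
  case: (\int[Q]_x _) => // y _; rewrite lee_fin => y0 Ht.
  have {}Ht (t : R) : (0 <= t -> 2 * (t * x) <= B + t * t * y)%R.
    by move=> /Ht; rewrite -!EFinM -EFinD lee_fin.
  rewrite -!EFinM lee_fin.
  move: y0; rewrite le_eqVlt => /predU1P[y0|y0].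
    rewrite -y0 mulr0; have [->|xN] := eqVneq x 0%R; first by rewrite mulr0.
    have xp : (0 < x)%R by rewrite lt_def xN.
    (* With [y = 0] this [t] would give [2 (B + 1) <= B], against [B >= 0]. *)
    have := Ht ((B + 1) / x)%R; rewrite -y0 mulr0 addr0 divfK // => /(_ _).
    by rewrite divr_ge0 ?addr_ge0 // => /(_ isT); lra.
  (* The minimizer of [B + t^2 y - 2 t x]. *)
  have := Ht (x / y)%R; rewrite divr_ge0 ?(ltW y0) // => /(_ isT).
  have -> : (2 * (x / y * x) = 2 * (x * x / y))%R by ring.
  have -> : (x / y * (x / y) * y = x * x / y)%R by field; rewrite gt_eqF.
  move=> hB; have : (x * x / y <= B)%R by lra.
  by rewrite ler_pdivrMr.
have BI0 : 0 <= B%:E * I by exact: mule_ge0.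
have [->|BIfin] := eqVneq (B%:E * I) +oo; first exact: leey.
have [r rE] : exists r, B%:E * I = r%:E.
  by exists (fine (B%:E * I)); rewrite fineK // ge0_fin_numE // lt_neqAle BIfin leey.
have r0 : (0 <= r)%R by rewrite -lee_fin -rE.
have Pf : \int[P]_x f x <= (Num.sqrt r)%:E.
  rewrite ge0_integralTE //; apply: ge_ereal_sup => _ [h hf <-].
  rewrite -integralT_nnsfun.
  have := sq h hf; rewrite rE.
  have : 0 <= \int[P]_x (h x)%:E by apply: integral_ge0 => x _; rewrite lee_fin.
  case: (\int[P]_x _) => // x x0.
  rewrite -EFinM !lee_fin => x2; rewrite -(ger0_norm x0) -sqrtr_sqr.
  by rewrite ler_sqrt // expr2.
rewrite rE -(sqr_sqrtr r0) expr2 EFinM.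
by apply: lee_pmul => //; apply: integral_ge0.
Qed.

Lemma integral_probability_cst1 d (T : measurableType d) (P : probability T R) :
  \int[P]_x (cst 1 x) = 1.
Proof. by rewrite integral_cst // mul1e; exact: probability_setT. Qed.

(** Integrating [(h - 1)^2 >= 0] gives the linearized form. *)
Lemma chi2_bound_refl d (T : measurableType d) (P : probability T R) :
  chi2_bound P P 1.
Proof.
apply: chi2_boundE => h.
rewrite -ge0_integralZl //; [|by apply: measurableT_comp|by move=> x _; rewrite lee_fin].
rewrite -(integral_probability_cst1 P).
rewrite -ge0_integralD //; first last.
- by apply/measurable_EFinP; exact: measurable_funM.
- by move=> x _; rewrite lee_fin mulr_ge0.
apply: ge0_le_integral => //.
- by move=> x _; rewrite mule_ge0 // lee_fin.
- by apply: emeasurable_funM => //; exact/measurable_EFinP.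
- by apply: emeasurable_funD => //; apply/measurable_EFinP; exact: measurable_funM.
move=> x _; rewrite /= -EFinM -EFinD lee_fin -subr_ge0.
by rewrite [X in (0 <= X)%R](_ : _ = (h x - 1) ^+ 2)%R ?sqr_ge0 //; ring.
Qed.

Lemma chi2_bound_tuple d (Z : measurableType d) n (P Q : 'I_n -> probability Z R)
    (B : 'I_n -> R) :
  (forall i, 0 <= B i)%R -> (forall i, chi2_bound (P i) (Q i) (B i)) ->
  chi2_bound (tuple_probability P) (tuple_probability Q) (\prod_i B i)%R.
Proof.
elim: n P Q B => [|n IH] P Q B B0 h; first by rewrite big_ord0; exact: chi2_bound_refl.
rewrite big_ord_recl /=; apply: chi2_bound_distribution.
apply: chi2_bound_prod => //; first exact: prodr_ge0.
exact: IH.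
Qed.

Lemma chi2_bound_setE d (T : measurableType d) (P Q : probability T R) B (A : set T) :
  measurable A -> chi2_bound P Q B -> P A * P A <= B%:E * Q A.
Proof.
move=> mA /(_ (EFin \o \1_A)); rewrite /= integral_indic // setIT => h.
apply: (le_trans (h _ _)).
- exact/measurable_EFinP.
- by move=> x; rewrite lee_fin.
rewrite (eq_integral (EFin \o \1_A)) => [|x _]; last first.
  by rewrite /= -EFinM indicE -natrM mulnb andbb.
by rewrite integral_indic // setIT.
Qed.

End Chi2.

(** * Simultaneous chi-square bounds for a finite family *)

Section FiniteLabel.
Local Open Scope ring_scope.
Context d (T : measurableType d) (R : realType).

Lemma integral_finite_label (P : probability T R) (J : finType) (k : T -> J)
    (h : J -> R) :
  (forall j, measurable (k @^-1` [set j])) -> (forall j, 0 <= h j) ->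
  (\int[P]_x (h (k x))%:E)%E = (\sum_j h j * fine (P (k @^-1` [set j])))%:E.
Proof.
move=> mk h0.
rewrite (eq_integral (fun x => \sum_j (h j)%:E * (\1_(k @^-1` [set j]) x)%:E)%E); last first.
  move=> x _; rewrite (bigD1 (k x)) //= big1 ?adde0 => [|j jk].
    by rewrite indicE mem_set // mule1.
  by rewrite indicE memNset ?mule0 //= => kj; rewrite kj eqxx in jk.
rewrite ge0_integral_sum //; last 2 first.
- move=> j; apply: emeasurable_funM => //; exact/measurable_EFinP.
- by move=> j x _; rewrite -EFinM lee_fin mulr_ge0.
rewrite -sumEFin; apply: eq_bigr => j _.
rewrite ge0_integralZl //; last 2 first.
- by apply/measurable_EFinP; exact: measurable_indic.
- by rewrite lee_fin.
by rewrite integral_indic // setIT EFinM fineK // fin_num_measure.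
Qed.

(** The label of a point is the tuple of the values of all the functions there; each range is
    finite, so there are finitely many labels. *)
Lemma nnsfun_common_label (I : finType) (g : I -> {nnsfun T >-> R}) :
  exists (J : finType) (k : T -> J) (h : I -> J -> R),
    [/\ forall j, measurable (k @^-1` [set j]), forall i j, 0 <= h i j &
        forall i x, g i x = h i (k x)].
Proof.
have /choice[r rP] : forall i, exists s : seq R, range (g i) = [set` s].
  by move=> i; exact/finite_seqP/fimfunP.
pose s := flatten [seq r i | i <- enum I].
have gs i x : g i x \in s.
  apply/flattenP; exists (r i); first by rewrite map_f // mem_enum.
  by have : range (g i) (g i x) by []; rewrite rP.
pose k x : {ffun I -> seq_sub s} := [ffun i => SeqSub (gs i x)].
exists {ffun I -> seq_sub s}, k,
  (fun i (j : {ffun I -> seq_sub s}) => `|ssval (j i)|); split => //.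
  move=> j; rewrite (_ : _ @^-1` _ = \big[setI/setT]_(i <- enum I) (g i @^-1` [set ssval (j i)])).
    by apply: bigsetI_measurable => i _; exact: measurable_funPTI.
  apply/seteqP; split => x /=.
    move=> <-; rewrite -bigcap_seq => i _ /=.
    by rewrite ffunE.
  rewrite -bigcap_seq => jx; apply/ffunP => i; rewrite ffunE; apply: val_inj => /=.
  by apply: jx => /=; rewrite mem_enum.
by move=> i x; rewrite ffunE /= ger0_norm.
Qed.

End FiniteLabel.

(** The choices for different [i] are independent, so the supremum of the sum is the sum of the
    suprema. Freezing all coordinates but one at [x0] shows that each supremum is finite. *)
Lemma sum_sup_le (R : realType) (I : finType) (X : Type) (x0 : X)
    (F : I -> X -> R) (C : R) :
  (forall g : I -> X, \sum_i F i (g i) <= C) ->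
  exists B : I -> R, (forall i x, F i x <= B i) /\ \sum_i B i <= C.
Proof.
move=> FC.
have ubF i : has_ubound (range (F i)).
  exists (C - \sum_(j | j != i) F j x0) => _ [x _ <-].
  have := FC (fun j => if j == i then x else x0).
  rewrite (bigD1 i) //= eqxx (eq_bigr (fun j => F j x0)) => [|j /negbTE -> //].
  by move=> h; rewrite lerBrDr.
have supF i : has_sup (range (F i)) by split; first by exists (F i x0), x0.
exists (fun i => sup (range (F i))); split.
  by move=> i x; apply: ub_le_sup => //; exists x.
apply/ler_addgt0Pr => e e0.
(* The successor keeps the denominator positive when [I] is empty. *)
pose del := e / #|I|.+1%:R.
have del0 : 0 < del by rewrite divr_gt0.
have /choice[g gP] : forall i, exists x, sup (range (F i)) - del < F i x.
  by move=> i; have [_ [x _ <-] hx] := sup_adherent del0 (supF i); exists x.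
apply: (@le_trans _ _ (\sum_i (F i (g i) + del))).
  by apply: ler_sum => i _; rewrite -lerBlDr ltW.
rewrite big_split /= lerD // sumr_const -mulr_natr /del -mulrA ger_pMr //.
by rewrite mulrC ler_pdivrMr // mul1r ler_nat leqnSn.
Qed.

(* The optimal B i is the supremum of 2 \int g dP_i - \int g^2 dQ_i over simple g;
   the test functions of all the i are constant on the cells of one finite
   partition, to each of which the hypothesis applies. *)
Lemma chi2_bound_family d (T : measurableType d) (R : realType) (I : finType)
    (P Q : I -> probability T R) (U : probability T R) (K : R) :
  (forall S, measurable S -> forall c : I -> R, (forall i, 0 <= c i) ->
    \sum_i (2 * c i * fine (P i S) - c i ^+ 2 * fine (Q i S)) <=
    \sum_i (2 * fine (P i S) - fine (Q i S)) + K * fine (U S)) ->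
  exists B : I -> R, [/\ forall i, 1 <= B i,
    forall i, chi2_bound (P i) (Q i) (B i) & \sum_i (B i - 1) <= K].
Proof.
move=> H.
pose F i (g : {nnsfun T >-> R}) :=
  2 * fine (\int[P i]_x (g x)%:E)%E - fine (\int[Q i]_x (g x * g x)%:E)%E.
(* At [g = 1] each [F i] equals 1: this accounts for [#|I|] here, and below for [1 <= B i]. *)
have [|B [FB BK]] := @sum_sup_le R I _ (nnsfun0 : {nnsfun T >-> R}) F (#|I|%:R + K).
  move=> g; have [J [k [h [mk h0 gk]]]] := nnsfun_common_label g.
  have FE i : F i (g i) = \sum_j (2 * h i j * fine (P i (k @^-1` [set j])) -
      h i j ^+ 2 * fine (Q i (k @^-1` [set j]))).
    rewrite /F; under eq_integral do rewrite gk.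
    under [in X in _ - X]eq_integral do rewrite gk.
    rewrite integral_finite_label // (integral_finite_label _ (h := fun j => h i j * h i j)) //.
      by rewrite /= mulr_sumr -sumrB; apply: eq_bigr => j _; ring.
    by move=> j; rewrite mulr_ge0.
  have tot (M : probability T R) : \sum_j fine (M (k @^-1` [set j])) = 1.
    have := integral_finite_label M mk (h := fun=> 1) (fun=> ler01).
    rewrite integral_probability_cst1 => -[->].
    by apply: eq_bigr => j _; rewrite mul1r.
  rewrite (eq_bigr _ (fun i _ => FE i)) exchange_big /=.
  apply: (le_trans (ler_sum _ (fun j _ => H _ (mk j) _ (h0^~ j)))).
  rewrite big_split /= -mulr_sumr tot mulr1 lerD2r exchange_big /=.
  rewrite (eq_bigr (fun=> 1)) ?sumr_const // => i _.
  by rewrite sumrB -mulr_sumr !tot; ring.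
exists B; split.
- move=> i; have := FB i (cst_nnsfun T (NngNum ler01)).
  rewrite /F (eq_integral (cst 1%E)) // (eq_integral (cst 1%E)) => [|x _]; last by rewrite /= mulr1.
  by rewrite !integral_probability_cst1 /=; lra.
- move=> i; apply: chi2_boundE => h; have := FB i h; rewrite /F.
  have := integral_nnsfun_fin_num (P i) h.
  have /= := integral_nnsfun_fin_num (Q i) (mul_nnsfun h h).
  case: (\int[P i]_x _)%E => // x; case: (\int[Q i]_x _)%E => // y _ _ /=.
  by rewrite -EFinM -EFinD lee_fin; lra.
by rewrite sumrB sumr_const; lra.
Qed.

(** * Qubit states and their fidelity *)

Section SquareRoot.
Context {C : numClosedFieldType} {d : nat}.
Implicit Types A psi : 'M[C]_d.

(** In the spectral basis, the equation says that every nonzero entry of [P *m X] sits in a row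
    whose eigenvalue is [a]; the square root turns this eigenvalue into [sqrtC a]. *)
Lemma mxsqrt_mulmx A k (X : 'M[C]_(d, k)) (a : C) : A \is hermsymmx ->
  A *m X = a *: X -> mxsqrt A *m X = sqrtC a *: X.
Proof.
move=> Ah AX; have /orthomx_spectralP AE := hermitian_normalmx Ah.
have Pu := unitarymx_unit (spectral_unitarymx A).
set P := spectralmx A in AE Pu *; rewrite /= -/P in AE.
have DY : diag_mx (spectral_diag A) *m (P *m X) = a *: (P *m X).
  rewrite scalemxAr -AX [in RHS]AE -/P !mulmxA mulmxV // mul1mx //.
have -> : mxsqrt A *m X =
    invmx P *m (diag_mx (map_mx sqrtC (spectral_diag A)) *m (P *m X)).
  by rewrite /mxsqrt !mulmxA.
rewrite (_ : _ *m (P *m X) = sqrtC a *: (P *m X)).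
  by rewrite -scalemxAr mulKmx.
move: (P *m X) DY => Y DY; apply/matrixP => i j; move/matrixP/(_ i j): DY.
rewrite !mul_diag_mx !mxE; have [->|Y0] := eqVneq (Y i j) 0.
  by rewrite !mulr0.
by move/(mulIf Y0) => ->.
Qed.

Lemma mulmx_mxsqrt A k (X : 'M[C]_(k, d)) (a : C) : A \is hermsymmx ->
  X *m A = a *: X -> X *m mxsqrt A = sqrtC a *: X.
Proof.
move=> Ah AX; have /orthomx_spectralP AE := hermitian_normalmx Ah.
have Pu := unitarymx_unit (spectral_unitarymx A).
set P := spectralmx A in AE Pu *; rewrite /= -/P in AE.
have DY : X *m invmx P *m diag_mx (spectral_diag A) = a *: (X *m invmx P).
  rewrite scalemxAl -AX [in RHS]AE -/P !mulmxA mulmxK //.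
rewrite /mxsqrt -/P !mulmxA.
rewrite (_ : X *m _ *m _ = sqrtC a *: (X *m invmx P)).
  by rewrite -scalemxAl mulmxKV.
move: (X *m invmx P) DY => Y DY; apply/matrixP => i j; move/matrixP/(_ i j): DY.
rewrite !mul_mx_diag !mxE; have [->|Y0] := eqVneq (Y i j) 0.
  by rewrite !(mul0r, mulr0).
by rewrite ![_ * Y i j]mulrC => /(mulfI Y0) ->.
Qed.

(** The identity splits into [psi], whose columns are eigenvectors for [c], and [1 - psi], whose
    columns are killed. *)
Lemma mxsqrt_projection psi (c : C) : psi \is hermsymmx -> 
  c *: psi \is hermsymmx -> psi *m psi = psi ->
  mxsqrt (c *: psi) = sqrtC c *: psi.
Proof.
move=> psih cpsih psi2.
rewrite -[LHS]mulmx1 -(subrK psi 1%:M) mulmxDr.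
rewrite (@mxsqrt_mulmx _ _ psi c) // -?scalemxAl ?psi2 //.
rewrite (@mxsqrt_mulmx _ _ (1%:M - psi) 0) ?sqrtC0 ?scale0r ?add0r //.
by rewrite -scalemxAl mulmxBr mulmx1 psi2 subrr scaler0.
Qed.

Lemma outer_mulmx (u v : 'rV[C]_d) (a b c n : C) :
  u *m u^t* = n%:M -> v *m u^t* = 0 ->
  (a *: (u^t* *m u) + b *: (v^t* *m v)) *m (c *: (u^t* *m u)) =
  (a * n) *: (c *: (u^t* *m u)).
Proof.
move=> uu vu; rewrite -scalemxAr mulmxDl -2!scalemxAl.
rewrite (_ : _ *m v *m _ = 0); last by rewrite -mulmxA (mulmxA v) vu mul0mx mulmx0.
rewrite (_ : _ *m u *m _ = n *: (u^t* *m u)); last first.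
  by rewrite -mulmxA (mulmxA u) uu mul_scalar_mx -scalemxAr.
by rewrite scaler0 addr0 !scalerA; congr (_ *: _); ring.
Qed.

Lemma mulmx_outer (u v : 'rV[C]_d) (a b c n : C) :
  u *m u^t* = n%:M -> u *m v^t* = 0 ->
  (c *: (u^t* *m u)) *m (a *: (u^t* *m u) + b *: (v^t* *m v)) =
  (a * n) *: (c *: (u^t* *m u)).
Proof.
move=> uu uv; rewrite -scalemxAl mulmxDr -2!scalemxAr.
rewrite (_ : _ *m (v^t* *m v) = 0); last by rewrite -mulmxA (mulmxA u) uv mul0mx mulmx0.
rewrite (_ : _ *m (u^t* *m u) = n *: (u^t* *m u)); last first.
  by rewrite -mulmxA (mulmxA u) uu mul_scalar_mx -scalemxAr.
by rewrite scaler0 addr0 !scalerA; congr (_ *: _); ring.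
Qed.

Lemma tr_outerD (u v : 'rV[C]_d) (a b n : C) :
  u *m u^t* = n%:M -> v *m v^t* = n%:M ->
  \tr (a *: (u^t* *m u) + b *: (v^t* *m v)) = (a + b) * n.
Proof.
move=> uu vv; rewrite mxtraceD !mxtraceZ (mxtrace_mulC _ u) (mxtrace_mulC _ v) uu vv.
by rewrite mxtrace_scalar mulr1n mulrDl.
Qed.

Lemma tr_outerD_mulmx (u v : 'rV[C]_d) (a b : C) E :
  \tr ((a *: (u^t* *m u) + b *: (v^t* *m v)) *m E) =
  a * quad_form E u + b * quad_form E v.
Proof.
have trE (w : 'rV[C]_d) : \tr (w^t* *m w *m E) = quad_form E w.
  by rewrite -mulmxA mxtrace_mulC /quad_form [X in \tr X]mx11_scalar mxtrace_scalar mulr1n.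
by rewrite mulmxDl mxtraceD -!scalemxAl !mxtraceZ !trE.
Qed.

(** The projection is its own square root and absorbs that of [M] up to the factor [c], so both
    products of square roots are [c *: psi], of trace norm [c]. *)
Lemma fidelity_eigenprojection psi M (c : C) :
  psi \is hermsymmx -> M \is hermsymmx -> 0 <= c ->
  psi *m psi = psi -> \tr psi = 1 ->
  M *m psi = c ^+ 2 *: psi -> psi *m M = c ^+ 2 *: psi ->
  fidelity M psi = c /\ fidelity psi M = c.
Proof.
move=> psih Mh c0 psi2 tr1 Mpsi psiM.
have psiadj : psi^t* = psi by move/is_hermitianmxP: psih; rewrite expr0 scale1r => <-.
have adjZ e : (e *: psi)^t* = Num.conj e *: psi.
  by rewrite linearZ /= map_mxZ psiadj.
have cC : Num.conj c = c by apply/CrealP; exact: ger0_real.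
have sqrt_psi : mxsqrt psi = psi.
  by rewrite -{1}[psi]scale1r mxsqrt_projection ?sqrtC1 ?scale1r.
have scaledh : c ^+ 2 *: psi \is hermsymmx.
  by apply/is_hermitianmxP; rewrite expr0 scale1r adjZ rmorphXn /= cC.
have tn : trace_norm (c *: psi) = c.
  rewrite /trace_norm adjZ cC -scalemxAl -scalemxAr psi2 scalerA.
  by rewrite -expr2 mxsqrt_projection // sqrCK // mxtraceZ tr1 mulr1.
split; rewrite /fidelity sqrt_psi.
  by rewrite (@mxsqrt_mulmx _ _ psi (c ^+ 2)) // sqrCK.
by rewrite (@mulmx_mxsqrt _ _ psi (c ^+ 2)) // sqrCK.
Qed.

End SquareRoot.

(** * Pure qubits, their orthogonal states and mixtures *)

Section Qubit.
Context (R : realType) (d : nat).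
Implicit Types (A E : 'M[R[i]]_d.+2) (a b : R[i]).

(** The qubit lives in the span of the first two basis vectors, so that every dimension at least 2
    is treated at once. *)
Definition ket a b : 'rV[R[i]]_d.+2 :=
  a *: delta_mx 0 0 + b *: delta_mx 0 1.

Lemma ket_form A a b a' b' : (ket a b *m A *m (ket a' b')^t*) 0 0 =
  a * Num.conj a' * A 0 0 + a * Num.conj b' * A 0 1 + b * Num.conj a' * A 1 0 +
  b * Num.conj b' * A 1 1.
Proof.
have cell (i j : 'I_d.+2) : ((delta_mx 0 i : 'rV_d.+2) *m A *m (delta_mx j 0 : 'cV_d.+2)) 0 0 = A i j.
  by rewrite -rowE -colE !mxE.
rewrite /ket linearD /= !linearZ /= map_mxD !map_mxZ !trmx_delta !map_delta_mx.
rewrite !(mulmxDl, mulmxDr, =^~ scalemxAl, =^~ scalemxAr).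
rewrite -(cell 0 0) -(cell 0 1) -(cell 1 0) -(cell 1 1).
move: (delta_mx 0 0 *m A *m delta_mx 0 0) (delta_mx 0 0 *m A *m delta_mx 1 0).
move: (delta_mx 0 1 *m A *m delta_mx 0 0) (delta_mx 0 1 *m A *m delta_mx 1 0).
move=> M10 M11 M00 M01; rewrite !mxE /=; ring.
Qed.

Lemma ket_dot a b a' b' : ket a b *m (ket a' b')^t* =
  (a * Num.conj a' + b * Num.conj b')%:M.
Proof.
rewrite [LHS]mx11_scalar -{1}(mulmx1 (ket a b)) ket_form !mxE /=.
by rewrite !mulr0 !addr0 !mulr1.
Qed.

Lemma projector_psd (v : 'rV[R[i]]_d.+2) (c : R[i]) :
  0 <= c -> psdmx (c *: (v^t* *m v)).
Proof.
move=> c0; split.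
  apply/is_hermitianmxP; rewrite expr0 scale1r linearZ /= map_mxZ trmx_mul map_mxM.
  by rewrite trmxCK /= (CrealP (ger0_real c0)).
move=> w; rewrite /quad_form -scalemxAr -scalemxAl mxE mulr_ge0 //.
rewrite mulmxA -(mulmxA _ v).
set x := w *m v^t*.
have -> : v *m w^t* = x^t*.
  by rewrite /x trmx_mul map_mxM trmxCK.
by rewrite mxE big_ord1 !mxE mul_conjC_ge0.
Qed.

Lemma psdmx_add n (A B : 'M[R[i]]_n) : psdmx A -> psdmx B -> psdmx (A + B).
Proof.
move=> [Ah A0] [Bh B0]; split; last first.
  by move=> v; rewrite /quad_form mulmxDr mulmxDl mxE addr_ge0 ?A0 ?B0.
apply/is_hermitianmxP; move/is_hermitianmxP: Ah; move/is_hermitianmxP: Bh.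
by rewrite !expr0 !scale1r linearD /= map_mxD => <- <-.
Qed.

(* Unnormalized: the vectors (1, z) and (- z^*, 1), with z = x + i y. *)
Definition qubit (x y : R) := ket 1 (x +i* y).
Definition coqubit (x y : R) := ket (- (x -i* y)) 1.
Definition qubit_sqnorm (x y : R) : R := 1 + x ^+ 2 + y ^+ 2.

Lemma qubit_sqnorm_gt0 x y : 0 < qubit_sqnorm x y.
Proof. by rewrite /qubit_sqnorm -addrA ltr_wpDr ?addr_ge0 ?sqr_ge0. Qed.

Lemma conj_complex (x y : R) : Num.conj (x +i* y) = x -i* y.
Proof. by []. Qed.

Lemma qubit_dot x y : qubit x y *m (qubit x y)^t* = (qubit_sqnorm x y)%:C%:M.
Proof.
rewrite ket_dot; congr (_%:M).
rewrite rmorph1 conj_complex mulr1 /qubit_sqnorm.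
by apply/eqP; rewrite eq_complex /=; apply/andP; split; apply/eqP; ring.
Qed.

Lemma coqubit_dot x y : coqubit x y *m (coqubit x y)^t* = (qubit_sqnorm x y)%:C%:M.
Proof.
rewrite ket_dot; congr (_%:M).
rewrite rmorphN rmorph1 /= conj_complex mulr1 /qubit_sqnorm.
by apply/eqP; rewrite eq_complex /=; apply/andP; split; apply/eqP; ring.
Qed.

Lemma qubit_coqubit_dot x y : qubit x y *m (coqubit x y)^t* = 0.
Proof.
rewrite ket_dot rmorphN rmorph1 /= conj_complex mulr1 mul1r.
rewrite (_ : _ + _ = 0) ?raddf0 //.
by apply/eqP; rewrite eq_complex /=; apply/andP; split; apply/eqP; ring.
Qed.

Lemma coqubit_qubit_dot x y : coqubit x y *m (qubit x y)^t* = 0.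
Proof.
rewrite ket_dot rmorph1 conj_complex mulr1 mul1r.
rewrite (_ : _ + _ = 0) ?raddf0 //.
by apply/eqP; rewrite eq_complex /=; apply/andP; split; apply/eqP; ring.
Qed.

(** The two vectors are orthogonal with the same squared norm, so this is a spectral decomposition
    with eigenvalues [1 - eta] and [eta]; [eta = 0] gives the pure state. *)
Definition mixed_mx (x y eta : R) : 'M[R[i]]_d.+2 :=
  ((1 - eta) / qubit_sqnorm x y)%:C *: ((qubit x y)^t* *m qubit x y) +
  (eta / qubit_sqnorm x y)%:C *: ((coqubit x y)^t* *m coqubit x y).

Lemma mixed_mx_psd x y eta : 0 <= eta <= 1 -> psdmx (mixed_mx x y eta).
Proof.
move=> /andP[eta0 eta1]; have n0 := qubit_sqnorm_gt0 x y.
by apply: psdmx_add; apply: projector_psd; rewrite lecE /= eqxx /= divr_ge0 ?subr_ge0 // ltW.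
Qed.

Lemma mixed_mx_tr x y eta : \tr (mixed_mx x y eta) = 1.
Proof.
rewrite (tr_outerD _ _ (qubit_dot x y) (coqubit_dot x y)).
rewrite -(rmorphD (real_complex R)) -(rmorphM (real_complex R)) /=.
by rewrite -mulrDl subrK mul1r mulVf // gt_eqF ?qubit_sqnorm_gt0.
Qed.

Definition mixed_state x y eta (eta01 : 0 <= eta <= 1) : state R d.+2 :=
  State (mixed_mx_psd x y eta01) (mixed_mx_tr x y eta).

Lemma mixed_mx0 x y :
  mixed_mx x y 0 = (qubit_sqnorm x y)^-1%:C *: ((qubit x y)^t* *m qubit x y).
Proof. by rewrite /mixed_mx subr0 mul0r mul1r scale0r addr0. Qed.

Lemma mixed_mulmx x y eta :
  mixed_mx x y eta *m mixed_mx x y 0 = (1 - eta)%:C *: mixed_mx x y 0.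
Proof.
have n0 := qubit_sqnorm_gt0 x y.
rewrite mixed_mx0 (outer_mulmx _ _ _ (qubit_dot x y) (coqubit_qubit_dot x y)).
by rewrite -(rmorphM (real_complex R)) /= divfK // gt_eqF.
Qed.

Lemma mulmx_mixed x y eta :
  mixed_mx x y 0 *m mixed_mx x y eta = (1 - eta)%:C *: mixed_mx x y 0.
Proof.
have n0 := qubit_sqnorm_gt0 x y.
rewrite mixed_mx0 (mulmx_outer _ _ _ (qubit_dot x y) (qubit_coqubit_dot x y)).
by rewrite -(rmorphM (real_complex R)) /= divfK // gt_eqF.
Qed.

Lemma mixed_fidelity x y eps : 0 <= eps <= 1 ->
  let eta := 1 - (1 - eps) ^+ 2 in
  fidelity (mixed_mx x y eta) (mixed_mx x y 0) = (1 - eps)%:C /\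
  fidelity (mixed_mx x y 0) (mixed_mx x y eta) = (1 - eps)%:C.
Proof.
move=> /andP[eps0 eps1] eta.
have eta01 : 0 <= eta <= 1 by rewrite /eta; nra.
have z01 : 0 <= (0 : R) <= 1 by rewrite lexx ler01.
have [Mh _] := mixed_mx_psd x y eta01.
have [psih _] := mixed_mx_psd x y z01.
have etaE : (1 - eta)%:C = (1 - eps)%:C ^+ 2 :> R[i].
  by rewrite /eta opprB addrC subrK (rmorphXn (real_complex R)).
apply: (fidelity_eigenprojection psih Mh).
- by rewrite lecE /= eqxx subr_ge0.
- by rewrite (mulmx_mixed x y 0) subr0 scale1r.
- exact: mixed_mx_tr.
- by rewrite (mixed_mulmx x y eta) etaE.
- by rewrite (mulmx_mixed x y eta) etaE.
Qed.

Lemma quad_form_qubit E x y : complex.Re (quad_form E (qubit x y)) =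
  complex.Re (E 0 0) + x * (complex.Re (E 0 1) + complex.Re (E 1 0)) +
  y * (complex.Im (E 0 1) - complex.Im (E 1 0)) +
  (x ^+ 2 + y ^+ 2) * complex.Re (E 1 1).
Proof.
rewrite /quad_form ket_form rmorph1 conj_complex.
by case: (E 0 0) (E 0 1) (E 1 0) (E 1 1) => [? ?] [? ?] [? ?] [? ?] /=; ring.
Qed.

(** After normalization the two vectors form an orthonormal basis of the qubit, so their quadratic
    forms add up to the trace of the 2 x 2 block. *)
Lemma quad_form_coqubit E x y : complex.Re (quad_form E (coqubit x y)) =
  qubit_sqnorm x y * (complex.Re (E 0 0) + complex.Re (E 1 1)) -
  complex.Re (quad_form E (qubit x y)).
Proof.
rewrite [X in _ - X]quad_form_qubit /quad_form ket_form rmorphN rmorph1 /= conj_complex /qubit_sqnorm.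
by case: (E 0 0) (E 0 1) (E 1 0) (E 1 1) => [? ?] [? ?] [? ?] [? ?] /=; ring.
Qed.

Lemma mixed_outcome E x y eta : complex.Re (\tr (mixed_mx x y eta *m E)) =
  (1 - eta) * (complex.Re (quad_form E (qubit x y)) / qubit_sqnorm x y) +
  eta * (complex.Re (E 0 0) + complex.Re (E 1 1) -
    complex.Re (quad_form E (qubit x y)) / qubit_sqnorm x y).
Proof.
have n0 := qubit_sqnorm_gt0 x y.
rewrite tr_outerD_mulmx.
have ReM (c : R) (z : R[i]) : complex.Re (c%:C * z) = c * complex.Re z.
  by case: z => ? ? /=; ring.
have ReD (z w : R[i]) : complex.Re (z + w) = complex.Re z + complex.Re w.
  by case: z; case: w.
move: (quad_form E (qubit x y)) (quad_form E (coqubit x y)) (quad_form_coqubit E x y).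
move=> q1 q2 q2E; rewrite ReD !ReM q2E.
by field; exact: lt0r_neq0.
Qed.

End Qubit.

(** * Lattice sums *)

Section Lattice.
Context (R : realType).

(** This is [ln (1 + u) <= u] at [u = - 1 / (n + 2)]; it lets the logarithm pay for one more
    harmonic term. *)
Lemma ln_succ_ge (n : nat) : (n.+2%:R)^-1 <= ln (n.+2%:R : R) - ln n.+1%:R.
Proof.
have := @le_ln1Dx R (- (n.+2%:R)^-1).
rewrite ltrN2 invf_lt1 ?ltr0n // ltr1n => /(_ isT).
rewrite (_ : 1 - _ = n.+1%:R / n.+2%:R); last first.
  by apply: (mulIf (x := n.+2%:R)); rewrite ?pnatr_eq0 // divfK ?pnatr_eq0 //
    mulrBl mul1r mulVf ?pnatr_eq0 // -[n.+2%:R]natr1 addrK.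
by rewrite ln_div ?posrE ?ltr0n // lerNr opprB.
Qed.

(* The farther of the two extreme points is at distance at least n/2 from -x,
   so that it can be removed. *)
Lemma sum_inv_dist_le (n : nat) (x : R) :
  \sum_(j < n.+1) (1 + `|j%:R + x|)^-1 <= 2 * (1 + ln n.+1%:R).
Proof.
elim: n x => [|n IH] x.
  rewrite big_ord1 ln1 addr0 mulr1 (@le_trans _ _ 1) ?ler1n //.
  by rewrite invf_le1 ?ltr_wpDr // lerDl.
have far (y : R) : n.+1%:R <= 2 * y -> (1 + y)^-1 <= 2 * (n.+2%:R)^-1.
  move=> ny; have n0 : 0 <= n.+1%:R :> R by [].
  rewrite -[leRHS]invf_div lef_pV2 ?posrE ?divr_gt0 ?ltr0n //; last by lra.
  by rewrite ler_pdivrMr // -[n.+2]addn1 natrD; lra.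
have step (u v : R) : u <= 2 * (1 + ln n.+1%:R) -> v <= 2 * (n.+2%:R)^-1 ->
    u + v <= 2 * (1 + ln n.+2%:R).
  move=> hu hv; apply: (le_trans (lerD hu hv)); rewrite -mulrDr ler_pM2l //.
  by rewrite -addrA lerD2l -lerBrDl ln_succ_ge.
have sumge : n.+1%:R <= `|n.+1%:R + x| + `|x|.
  by rewrite -[leLHS]normr_nat -{1}(addrK x n.+1%:R) ler_normB.
case: (leP `|x| `|n.+1%:R + x|) => xn.
  rewrite big_ord_recr /=; apply: step; first exact: IH.
  by apply: far; apply: (le_trans sumge); rewrite mulr2n mulrDl !mul1r lerD2l.
rewrite big_ord_recl /= add0r.
(* Without its first point, the sum is the shorter one with [x] shifted by 1. *)
rewrite (eq_bigr (fun j : 'I_n.+1 => (1 + `|j%:R + (1 + x)|)^-1)) => [|j _]; last first.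
  by rewrite /bump /= add1n -natr1 addrA.
rewrite addrC; apply: step; first exact: IH.
by apply: far; apply: (le_trans sumge); rewrite mulr2n mulrDl !mul1r lerD2r ltW.
Qed.

(** Here [p] and [Q] are the probabilities of an effect in the pure and in the noisy state, and [t]
    is the trace of its qubit block. The maximum over [c] exceeds the value at [c = 1] by
    [(p - Q)^2 / Q], where [|p - Q| <= eta t] and [Q >= w t / 8]. *)
Lemma cell_term (p t eta c w : R) : 0 <= p <= t -> 0 <= eta <= 7 / 16 -> 0 < w ->
  w * t <= p + eta * t ->
  2 * c * p - c ^+ 2 * ((1 - eta) * p + eta * (t - p)) <=
  2 * p - ((1 - eta) * p + eta * (t - p)) + 8 * eta ^+ 2 * t / w.
Proof.
move=> /andP[p0 pt] /andP[eta0 eta1] w0 wt.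
set Q := (1 - eta) * p + eta * (t - p).
have QE : Q = (1 - eta) * p + eta * (t - p) by [].
(* [Q = (1 - 2 eta) p + eta t], and [eta <= 7 / 16] gives [1 - 2 eta >= 1 / 8]. *)
have QP : (p + eta * t) / 8 <= Q by rewrite QE; nra.
have [t0|tN0] := eqVneq t 0.
  have pz : p = 0 by lra.
  by rewrite QE pz t0; lra.
have tp : 0 < t by rewrite lt_def tN0; lra.
have Qp : 0 < Q by have := mulr_gt0 w0 tp; lra.
rewrite -lerBlDl.
have -> : 2 * c * p - c ^+ 2 * Q - (2 * p - Q) =
    2 * (c - 1) * (p - Q) - (c - 1) ^+ 2 * Q by ring.
(* Completing the square in [c - 1]. *)
apply: (@le_trans _ _ ((p - Q) ^+ 2 / Q)).
  rewrite ler_pdivlMr //; have := sqr_ge0 (p - Q - (c - 1) * Q); lra.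
have -> : 8 * eta ^+ 2 * t / w = (eta * t) ^+ 2 / (w * t / 8).
  by field; rewrite tN0 gt_eqF.
apply: ler_pM; rewrite ?invr_ge0 ?sqr_ge0 ?(ltW Qp) //.
  have -> : (p - Q) ^+ 2 = (eta * (2 * p - t)) ^+ 2 by rewrite QE; ring.
  by rewrite !exprMn ler_wpM2l ?sqr_ge0 //; nra.
by rewrite lef_pV2 ?posrE ?divr_gt0 ?mulr_gt0 //; lra.
Qed.

(* If dd is not small then q is at least dd times the squared distance to its
   minimizer; otherwise q is of the order of a + dd on the whole square.  The
   bound u^2 + v^2 + 1 >= (1 + |u|) (1 + |v|) / 2 separates the coordinates. *)
Lemma quadratic_lower_bound (a b1 b2 dd : R) (N : nat) :
  let q x y := a + x * b1 + y * b2 + (x ^+ 2 + y ^+ 2) * dd in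
  (0 < N)%N -> 0 <= a -> 0 <= dd -> (forall x y, 0 <= q x y) ->
  exists X Y : R, forall (eta : R) (j k : 'I_N), 1 <= eta * N%:R ^+ 2 ->
    let x := j%:R / (2 * N%:R) in let y := k%:R / (2 * N%:R) in
    (1 + `|j%:R + X|) * (1 + `|k%:R + Y|) / (96 * N%:R ^+ 2) * (a + dd) <=
    q x y / (1 + x ^+ 2 + y ^+ 2) + eta * (a + dd).
Proof.
move=> q N0 a0 d0 q0.
have NR : (0 : R) < N%:R by rewrite ltr0n.
have coord (j : 'I_N) : 0 <= (j%:R / (2 * N%:R) : R) <= 1 / 2.
  apply/andP; split; first by rewrite divr_ge0 ?mulr_ge0.
  rewrite ler_pdivrMr ?mulr_gt0 // mulrA divfK // mul1r.
  by rewrite ler_nat ltnW.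
have prod_le (u v : R) : (1 + `|u|) * (1 + `|v|) <= 2 * (u ^+ 2 + v ^+ 2 + 1).
  rewrite -(real_normK (num_real u)) -(real_normK (num_real v)).
  have := sqr_ge0 (`|u| - `|v|); have := sqr_ge0 (`|u| - 1).
  have := sqr_ge0 (`|v| - 1); have := sqr_ge0 `|u|; have := sqr_ge0 `|v|; lra.
have N2 : 0 < N%:R ^+ 2 :> R by rewrite exprn_gt0.
have [dlarge|dsmall] := ltP ((a + dd) / 8) dd.
  have dp : 0 < dd by lra.
  (* The minimizer of [q] is [(- b1 / (2 dd), - b2 / (2 dd))]; in units of the mesh [1 / (2 N)] it
     is [(- X, - Y)]. *)
  exists (N%:R * b1 / dd), (N%:R * b2 / dd) => eta j k etaN /=.
  set x := j%:R / (2 * N%:R); set y := k%:R / (2 * N%:R).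
  have [x01 y01] : 0 <= x <= 1 / 2 /\ 0 <= y <= 1 / 2 by split; exact: coord.
  have n0 : 0 < 1 + x ^+ 2 + y ^+ 2 by nra.
  have n1 : 1 + x ^+ 2 + y ^+ 2 <= 3 / 2 by nra.
  set u := j%:R + _; set v := k%:R + _.
  have uE : u = 2 * N%:R * (x + b1 / (2 * dd)).
    by rewrite /u /x; field; rewrite !gt_eqF.
  have vE : v = 2 * N%:R * (y + b2 / (2 * dd)).
    by rewrite /v /y; field; rewrite !gt_eqF.
  have qE : q x y = dd * ((u ^+ 2 + v ^+ 2) / (4 * N%:R ^+ 2)) +
      q (- (b1 / (2 * dd))) (- (b2 / (2 * dd))).
    by rewrite uE vE /q; field; rewrite !gt_eqF.
  have s0 : 0 <= (u ^+ 2 + v ^+ 2) / (4 * N%:R ^+ 2).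
    by rewrite divr_ge0 ?addr_ge0 ?sqr_ge0 // mulr_ge0 // ltW.
  have qge : (a + dd) / 8 * ((u ^+ 2 + v ^+ 2) / (4 * N%:R ^+ 2)) <= q x y.
    rewrite qE -[leLHS]addr0 lerD // ler_wpM2r //; lra.
  have pge : 2 / 3 * q x y <= q x y / (1 + x ^+ 2 + y ^+ 2).
    by rewrite ler_pdivlMr //; have := q0 x y; nra.
  have ineq := prod_le u v.
  apply: (@le_trans _ _ (2 * (u ^+ 2 + v ^+ 2 + 1) / (96 * N%:R ^+ 2) * (a + dd))).
    rewrite ler_wpM2r ?addr_ge0 // ler_wpM2r // invr_ge0 mulr_ge0 //; lra.
  (* The constant 96 is the product of 2 (separation of the coordinates), 3/2 (squared norm), 8
     (threshold for [dd]) and 4 (squared mesh). The last term is paid for by [eta (a + dd)], as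
     [eta N^2 >= 1]. *)
  have -> : 2 * (u ^+ 2 + v ^+ 2 + 1) / (96 * N%:R ^+ 2) * (a + dd) =
      2 / 3 * ((a + dd) / 8 * ((u ^+ 2 + v ^+ 2) / (4 * N%:R ^+ 2))) +
      (a + dd) / (48 * N%:R ^+ 2) by field; rewrite gt_eqF.
  apply: lerD; first by lra.
  rewrite ler_pdivrMr ?mulr_gt0 //.
  have : (a + dd) * 1 <= (a + dd) * (eta * N%:R ^+ 2) by rewrite ler_wpM2l ?addr_ge0.
  have := mulr_ge0 (addr_ge0 a0 d0) (ltW N2); nra.
exists 0, 0 => eta j k etaN /=.
set x := j%:R / (2 * N%:R); set y := k%:R / (2 * N%:R).
have [x01 y01] : 0 <= x <= 1 / 2 /\ 0 <= y <= 1 / 2 by split; exact: coord.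
have n0 : 0 < 1 + x ^+ 2 + y ^+ 2 by nra.
have n1 : 1 + x ^+ 2 + y ^+ 2 <= 3 / 2 by nra.
have qge : 3 / 8 * (a + dd) <= q x y.
  (* Nonnegativity at the doubled point controls the linear part: [q x y >= a / 2 - (x^2 + y^2) dd
     >= (a - dd) / 2], and [dd <= (a + dd) / 8]. *)
  have := q0 (2 * x) (2 * y); rewrite /q => q2.
  have : (x ^+ 2 + y ^+ 2) * dd <= 1 / 2 * dd by rewrite ler_wpM2r //; nra.
  lra.
have pge : 1 / 4 * (a + dd) <= q x y / (1 + x ^+ 2 + y ^+ 2).
  by rewrite ler_pdivlMr //; nra.
have etap : 0 <= eta by rewrite -(pmulr_lge0 _ N2); lra.
rewrite !addr0 !normr_nat.
have jN (i : 'I_N) : 1 + i%:R <= N%:R :> R by rewrite -[1]/(1%:R) -natrD ler_nat add1n.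
have jkN : (1 + j%:R) * (1 + k%:R) <= N%:R ^+ 2 :> R by rewrite expr2 ler_pM ?addr_ge0.
have : (1 + j%:R) * (1 + k%:R) / (96 * N%:R ^+ 2) <= 1 / 4 :> R.
  by rewrite ler_pdivrMr ?mulr_gt0 //; lra.
move=> w4.
have := ler_wpM2r (addr_ge0 a0 d0) w4; have := mulr_ge0 etap (addr_ge0 a0 d0); lra.
Qed.

(** [cell_term] is summed with the weights of [quadratic_lower_bound]. These factor over the
    coordinates, so the sum of their inverses is a product of two harmonic sums;
    [3072 = 8 * 96 * 2^2]. *)
Lemma lattice_chi2_le (a b1 b2 dd eta : R) (n : nat) (c : 'I_n.+1 * 'I_n.+1 -> R) :
  let q x y := a + x * b1 + y * b2 + (x ^+ 2 + y ^+ 2) * dd in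
  let p (i : 'I_n.+1 * 'I_n.+1) :=
    let x := i.1%:R / (2 * n.+1%:R) in let y := i.2%:R / (2 * n.+1%:R) in
    q x y / (1 + x ^+ 2 + y ^+ 2) in
  let r i := (1 - eta) * p i + eta * (a + dd - p i) in
  0 <= a -> 0 <= dd -> (forall x y, 0 <= q x y) -> (forall i, p i <= a + dd) ->
  0 <= eta <= 7 / 16 -> 1 <= eta * n.+1%:R ^+ 2 ->
  \sum_i (2 * c i * p i - c i ^+ 2 * r i) <=
  \sum_i (2 * p i - r i) +
  3072 * (eta * n.+1%:R * (1 + ln n.+1%:R)) ^+ 2 * (a + dd).
Proof.
move=> q p r a0 d0 q0 pt eta01 etaN.
have [X [Y XY]] := quadratic_lower_bound (ltn0Sn n) a0 d0 q0.
pose w (i : 'I_n.+1 * 'I_n.+1) : R :=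
  (1 + `|i.1%:R + X|) * (1 + `|i.2%:R + Y|) / (96 * n.+1%:R ^+ 2).
have N2 : 0 < n.+1%:R ^+ 2 :> R by rewrite exprn_gt0.
have l0 (u : R) : 0 < 1 + `|u| by rewrite ltr_wpDr.
have w0 i : 0 < w i by rewrite /w divr_gt0 ?mulr_gt0.
have p0 i : 0 <= p i.
  by rewrite /p divr_ge0 // -addrA addr_ge0 // addr_ge0 ?sqr_ge0.
apply: (@le_trans _ _ (\sum_i (2 * p i - r i + 8 * eta ^+ 2 * (a + dd) / w i))).
  apply: ler_sum => i _; apply: cell_term => //; first by rewrite p0 pt.
  exact: XY.
rewrite big_split /= lerD2l -mulr_sumr.
have sumw : \sum_i (w i)^-1 <= 96 * n.+1%:R ^+ 2 * (2 * (1 + ln n.+1%:R)) ^+ 2.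
  rewrite (eq_bigr (fun i : 'I_n.+1 * 'I_n.+1 => 96 * n.+1%:R ^+ 2 *
      ((1 + `|i.1%:R + X|)^-1 * (1 + `|i.2%:R + Y|)^-1))) => [|i _]; last first.
    by rewrite /w invf_div mulrC invfM mulrC.
  rewrite -mulr_sumr ler_pM2l ?mulr_gt0 //.
  rewrite -(pair_big xpredT xpredT (fun j k : 'I_n.+1 =>
    (1 + `|j%:R + X|)^-1 * (1 + `|k%:R + Y|)^-1)) /=.
  under eq_bigr do rewrite -mulr_sumr.
  rewrite -mulr_suml expr2 ler_pM ?sum_inv_dist_le //.
    by apply: sumr_ge0 => j _; rewrite invr_ge0 ltW.
  by apply: sumr_ge0 => j _; rewrite invr_ge0 ltW.
have -> : 3072 * (eta * n.+1%:R * (1 + ln n.+1%:R)) ^+ 2 * (a + dd) =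
    8 * eta ^+ 2 * (a + dd) * (96 * n.+1%:R ^+ 2 * (2 * (1 + ln n.+1%:R)) ^+ 2).
  by ring.
by rewrite ler_wpM2l // mulr_ge0 ?addr_ge0 // mulr_ge0 ?sqr_ge0.
Qed.

End Lattice.

(** * Testing *)

Section Testing.
Context (R : realType).

(** A division-free form of [\prod B <= 1 / (1 - \sum (B - 1))]. The induction step is
    [b (2 - b - s) <= 1 - s] for [b >= 1] and [s >= 0]. *)
Lemma prod_mul_sum_le1 n (B : 'I_n -> R) : (forall i, 1 <= B i) ->
  (\prod_i B i) * (1 - \sum_i (B i - 1)) <= 1.
Proof.
elim: n B => [|n IH] B B1; first by rewrite !big_ord0 subr0 mulr1.
rewrite !big_ord_recl; set p := \prod_(i < n) _; set s := \sum_(i < n) _.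
have p0 : 0 <= p by apply: prodr_ge0 => i _; apply: le_trans (B1 _).
have s0 : 0 <= s by apply: sumr_ge0 => i _; rewrite subr_ge0.
have ps : p * (1 - s) <= 1 by exact: IH.
have b1 := B1 ord0.
apply: le_trans ps; rewrite [B ord0 * p]mulrC -mulrA ler_wpM2l //; nra.
Qed.

(** For [D >= 1 / 3] the right-hand side is at least 2. Otherwise [B <= 3 / 2], and [p^2 <= B q]
    gives [p - q <= B / 4 <= 3 / 8]. *)
Lemma chi2_bound_test d (T : measurableType d) (P Q : probability T R)
    (B D : R) (A : set T) :
  measurable A -> chi2_bound P Q B -> 0 <= D -> B * (1 - D) <= 1 ->
  (P A + Q (~` A) <= (5 / 3 + D)%:E)%E.
Proof.
move=> mA PQ D0 BD.
have := chi2_bound_setE mA PQ; rewrite probability_setC //.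
have := probability_le1 P mA; have : (0 <= P A)%E by [].
have := probability_le1 Q mA; have : (0 <= Q A)%E by [].
case: (P A) => // p; case: (Q A) => // q.
rewrite -!EFinM -EFinB -EFinD !lee_fin => q0 q1 p0 p1 ppq.
have [D3|D3] := leP (1 / 3) D; first by lra.
have B2 : B <= 3 / 2.
  have [//|B0] := leP B 0; first by lra.
  nra.
nra.
Qed.

End Testing.

(** * From single copies to strategies and randomized algorithms *)

Section Strategies.
Context (R : realType) (d n m : nat).
Implicit Types (s : strategy R d n m) (rho sigma : state R d).

Lemma measurable_answer_eq s b : measurable [set z | answer (s := s) z = b].
Proof.
have := @measurable_answer _ _ _ _ s measurableT [set b] I.
by rewrite setTI.
Qed.

(** All copies are independent, so the product of their bounds is valid for the joint laws, which
    are then tested on the event that the answer is [true]. *)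
Lemma strategy_answers_le s rho1 sigma1 rho2 sigma2 (B : 'I_n -> R) (B' : 'I_m -> R) :
  (forall i, 1 <= B i) -> (forall j, 1 <= B' j) ->
  (forall i, chi2_bound (outcome_probability (strategy_rho s i) rho1)
    (outcome_probability (strategy_rho s i) rho2) (B i)) ->
  (forall j, chi2_bound (outcome_probability (strategy_sigma s j) sigma1)
    (outcome_probability (strategy_sigma s j) sigma2) (B' j)) ->
  (strategy_answers s rho1 sigma1 true + strategy_answers s rho2 sigma2 false <=
   (5 / 3 + (\sum_i (B i - 1) + \sum_j (B' j - 1)))%:E)%E.
Proof.
move=> B1 B1' PQ PQ'.
have B0 i : 0 <= B i by apply: le_trans (B1 i).
have B0' j : 0 <= B' j by apply: le_trans (B1' j).
rewrite /strategy_answers.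
rewrite (_ : [set z | answer z = false] = ~` [set z | answer (s := s) z = true]).
  apply: (@chi2_bound_test _ _ _ _ _ ((\prod_i B i) * (\prod_j B' j))).
  - exact: measurable_answer_eq.
  - apply: chi2_bound_prod; rewrite ?prodr_ge0 //; exact: chi2_bound_tuple.
  - by rewrite addr_ge0 ?sumr_ge0 // => i _; rewrite subr_ge0.
  have := prod_mul_sum_le1 B1; have := prod_mul_sum_le1 B1'.
  have : 0 <= \prod_i B i by apply: prodr_ge0.
  have : 0 <= \prod_j B' j by apply: prodr_ge0.
  have : 0 <= \sum_i (B i - 1) by apply: sumr_ge0 => i _; rewrite subr_ge0.
  have : 0 <= \sum_j (B' j - 1) by apply: sumr_ge0 => j _; rewrite subr_ge0.
  move: (\sum_j (B' j - 1)) (\sum_i (B i - 1)) (\prod_j B' j) (\prod_i B i).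
  move=> D' D p' p D'0 D0 p'0 p0 hp' hp.
  have [D1|D1] := leP 1 D.
    apply: (@le_trans _ _ 0) => //; rewrite mulr_ge0_le0 ?mulr_ge0 //; lra.
  (* [1 - (D + D') <= (1 - D) (1 - D')], so the two product bounds multiply. *)
  have := ler_wpM2l (mulr_ge0 p0 (_ : 0 <= 1 - D)) hp'.
  have := mulr_ge0 (mulr_ge0 p0 p'0) (mulr_ge0 D0 D'0).
  rewrite subr_ge0 => ? /(_ (ltW D1)); lra.
by apply/seteqP; split => z /=; case: (answer z).
Qed.

End Strategies.

Section Families.
Context (R : realType).

(** The sum over the family commutes with the integral over the seed, so a bound valid for every
    seed survives randomization. *)
Lemma algorithm_answers_le d n m (a : algorithm R d n m) (I : finType)
    (rho1 sigma1 rho2 sigma2 : I -> state R d) (C : R) :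
  (forall w : seed a, \sum_i (strategy_answers (seed_strategy w) (rho1 i) (sigma1 i) true +
     strategy_answers (seed_strategy w) (rho2 i) (sigma2 i) false) <= C%:E)%E ->
  (\sum_i (algorithm_answers a (rho1 i) (sigma1 i) true +
     algorithm_answers a (rho2 i) (sigma2 i) false) <= C%:E)%E.
Proof.
move=> H.
have ma rho sigma b : measurable_fun setT
    (fun w : seed a => strategy_answers (seed_strategy w) rho sigma b).
  exact: measurable_seed_strategy.
have a0 rho sigma b (w : seed a) : (0 <= strategy_answers (seed_strategy w) rho sigma b)%E.
  exact: measure_ge0.
rewrite /algorithm_answers.
under eq_bigr do rewrite -ge0_integralD //.
rewrite -ge0_integral_sum //; last 2 first.
- by move=> i; exact: emeasurable_funD.
- by move=> i w _; rewrite adde_ge0.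
apply: (@le_trans _ _ (\int[seed_law a]_w (cst C%:E w))%E).
  apply: ge0_le_integral => //.
  - by move=> w _; apply: sume_ge0 => i _; rewrite adde_ge0.
  - by apply: emeasurable_sum => i; exact: emeasurable_funD.
by rewrite integral_cst // [X in (_ * X)%E]probability_setT mule1.
Qed.

(* The flag tells which of the two unknown states differs in the second
   alternative. *)
Lemma strategy_family_le d n m (s : strategy R d n m) (side : bool) (I : finType)
    (psi rho : I -> state R d) (K : R) :
  ((0 < if side then n else m)%N -> forall E : povm R d (outcome s), exists B : I -> R, [/\ forall i, 1 <= B i,
    forall i, chi2_bound (outcome_probability E (psi i))
                         (outcome_probability E (rho i)) (B i) &
    \sum_i (B i - 1) <= K]) ->
  (\sum_i (strategy_answers s (psi i) (psi i) true +
     strategy_answers s (if side then rho i else psi i)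
       (if side then psi i else rho i) false) <=
   (#|I|%:R * (5 / 3) + (if side then n else m)%:R * K)%:E)%E.
Proof.
move=> H.
have bound (D : I -> R) k : \sum_i D i <= k%:R * K ->
    (\sum_i (5 / 3 + D i)%:E <= (#|I|%:R * (5 / 3) + k%:R * K)%:E)%E.
  move=> DK; rewrite sumEFin lee_fin big_split /= sumr_const -[X in X + _]mulr_natl.
  by rewrite lerD2l.
have sumB k (B : 'I_k -> I -> R) : (forall l, \sum_i (B l i - 1) <= K) ->
    \sum_i \sum_l (B l i - 1) <= k%:R * K.
  move=> BK; rewrite exchange_big /=.
  apply: (le_trans (ler_sum _ (fun l _ => BK l))).
  by rewrite sumr_const card_ord mulr_natl.
(* Copies of the state common to both alternatives have bound 1 and contribute nothing. *)
have sum0 k : \sum_(j < k) (1 - 1 : R) = 0 by rewrite big1 // => j _; rewrite subrr.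
have ord_gt0 k (l : 'I_k) : (0 < k)%N by exact: leq_ltn_trans (ltn_ord l).
case: side H => H.
  have /choice[B BP] := fun k : 'I_n => H (ord_gt0 _ k) (strategy_rho s k).
  apply: (le_trans _ (bound (fun i => \sum_k (B k i - 1)) n _)); last first.
    by apply: sumB => k; have [] := BP k.
  apply: lee_sum => i _.
  have := @strategy_answers_le _ _ _ _ s (psi i) (psi i) (rho i) (psi i)
    (fun k => B k i) (fun=> 1).
  rewrite /= sum0 addr0; apply => //; try (by move=> k; have [] := BP k).
  by move=> j; exact: chi2_bound_refl.
have /choice[B BP] := fun k : 'I_m => H (ord_gt0 _ k) (strategy_sigma s k).
apply: (le_trans _ (bound (fun i => \sum_k (B k i - 1)) m _)); last first.
  by apply: sumB => k; have [] := BP k.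
apply: lee_sum => i _.
have := @strategy_answers_le _ _ _ _ s (psi i) (psi i) (psi i) (rho i)
  (fun=> 1) (fun k => B k i).
rewrite /= sum0 add0r; apply => //; try (by move=> k; have [] := BP k).
by move=> j; exact: chi2_bound_refl.
Qed.

(** Success on both alternatives contributes at least [2 * 99 / 100] per instance, against [5 / 3]
    plus divergence; the gap exceeds [3 / 10]. *)
Lemma decides_family_le d n m (a : algorithm R d n m) (eps : R) (side : bool)
    (I : finType) (psi rho : I -> state R d) (K : R) :
  decides a eps ->
  (forall i, fidelity (psi i) (rho i) <= (1 - eps)%:C /\
     fidelity (rho i) (psi i) <= (1 - eps)%:C) ->
  ((0 < if side then n else m)%N ->
    forall disp (Z : measurableType disp) (E : povm R d Z),
    exists B : I -> R, [/\ forall i, 1 <= B i,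
      forall i, chi2_bound (outcome_probability E (psi i))
                           (outcome_probability E (rho i)) (B i) &
      \sum_i (B i - 1) <= K]) ->
  #|I|%:R * (3 / 10) <= (if side then n else m)%:R * K.
Proof.
move=> dec fid HK.
have := @algorithm_answers_le _ _ _ a I psi psi
  (fun i => if side then rho i else psi i) (fun i => if side then psi i else rho i)
  _ (fun w => strategy_family_le (side := side) (fun n0 E => HK n0 _ _ E)).
have : (\sum_(i : I) (99%:R / 100%:R + 99%:R / 100%:R)%:E <= \sum_i
   (algorithm_answers a (psi i) (psi i) true +
    algorithm_answers a (if side then rho i else psi i)
       (if side then psi i else rho i) false))%E.
  apply: lee_sum => i _; rewrite EFinD; apply: leeD.
    by apply: (dec (psi i) (psi i)).1.
  by have [f1 f2] := fid i; case: (side); apply: (dec _ _).2.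
move=> h1 h2; have := le_trans h1 h2.
rewrite sumEFin lee_fin sumr_const -[X in X <= _]mulr_natl.
have : 0 <= #|I|%:R :> R by []; lra.
Qed.

End Families.

(** * The hard lattice of qubits and the number of copies *)

Section QubitFamily.
Context (R : realType) (d n : nat) (eta : R).
Hypothesis eta01 : 0 <= eta <= 1.

Let zero01 : 0 <= (0 : R) <= 1.
Proof. by rewrite lexx ler01. Qed.
Let half01 : 0 <= (1 / 2 : R) <= 1.
Proof. by lra. Qed.

Definition lattice_coord (j : 'I_n.+1) : R := j%:R / (2 * n.+1%:R).

Definition pure_qubit (i : 'I_n.+1 * 'I_n.+1) : state R d.+2 :=
  mixed_state d (lattice_coord i.1) (lattice_coord i.2) zero01.

Definition noisy_qubit (i : 'I_n.+1 * 'I_n.+1) : state R d.+2 :=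
  mixed_state d (lattice_coord i.1) (lattice_coord i.2) eta01.

(* Half of the trace of the 2 x 2 block of an effect is its probability in the
   maximally mixed qubit state, hence a measure of total mass one. *)
Lemma povm_chi2_bound disp (Z : measurableType disp) (E : povm R d.+2 Z) :
  eta <= 7 / 16 -> 1 <= eta * n.+1%:R ^+ 2 ->
  exists B : 'I_n.+1 * 'I_n.+1 -> R, [/\ forall i, 1 <= B i,
    forall i, chi2_bound (outcome_probability E (pure_qubit i))
                         (outcome_probability E (noisy_qubit i)) (B i) &
    \sum_i (B i - 1) <= 6144 * (eta * n.+1%:R * (1 + ln n.+1%:R)) ^+ 2].
Proof.
move=> eta_le etaN; set K := 6144 * _.
apply: (@chi2_bound_family _ _ _ _ _ _
  (outcome_probability E (mixed_state d 0 0 half01))) => S mS c c0.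
have Re0 v : 0 <= complex.Re (quad_form (E S) v).
  by have [_ /(_ v)] := povm_psd E S; rewrite lecE => /andP[].
pose a := complex.Re (E S 0 0); pose dd := complex.Re (E S 1 1).
pose b1 := complex.Re (E S 0 1) + complex.Re (E S 1 0).
pose b2 := complex.Im (E S 0 1) - complex.Im (E S 1 0).
pose q x y := a + x * b1 + y * b2 + (x ^+ 2 + y ^+ 2) * dd.
have qE x y : complex.Re (quad_form (E S) (qubit d x y)) = q x y.
  exact: quad_form_qubit.
have coqE x y : complex.Re (quad_form (E S) (coqubit d x y)) =
    (1 + x ^+ 2 + y ^+ 2) * (a + dd) - q x y.
  by rewrite -qE; exact: quad_form_coqubit.
have q0 x y : 0 <= q x y by rewrite -qE; exact: Re0.
have coq0 x y : 0 <= (1 + x ^+ 2 + y ^+ 2) * (a + dd) - q x y.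
  by rewrite -coqE; exact: Re0.
have PE x y eta' (h : 0 <= eta' <= 1) :
    fine (outcome_probability E (mixed_state d x y h) S) =
    (1 - eta') * (q x y / (1 + x ^+ 2 + y ^+ 2)) +
    eta' * (a + dd - q x y / (1 + x ^+ 2 + y ^+ 2)).
  by rewrite -qE; exact: mixed_outcome.
have d0 : 0 <= dd by have := coq0 0 0; rewrite /q expr0n /=; lra.
have a0 : 0 <= a by have := q0 0 0; rewrite /q expr0n /=; lra.
pose p (i : 'I_n.+1 * 'I_n.+1) : R :=
  q (lattice_coord i.1) (lattice_coord i.2) /
    (1 + lattice_coord i.1 ^+ 2 + lattice_coord i.2 ^+ 2).
have pureE i : fine (outcome_probability E (pure_qubit i) S) = p i.
  by apply: etrans (PE _ _ _ _) _; rewrite subr0 mul1r mul0r addr0.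
have noisyE i : fine (outcome_probability E (noisy_qubit i) S) =
    (1 - eta) * p i + eta * (a + dd - p i).
  exact: PE.
have tE : fine (outcome_probability E (mixed_state d 0 0 half01) S) = (a + dd) / 2.
  by apply: etrans (PE _ _ _ _) _; rewrite /q expr0n /=; field.
have sE (c' : R) i : 2 * c' * fine (outcome_probability E (pure_qubit i) S) -
    c' ^+ 2 * fine (outcome_probability E (noisy_qubit i) S) =
    2 * c' * p i - c' ^+ 2 * ((1 - eta) * p i + eta * (a + dd - p i)).
  by congr (_ * _ - _ * _); [exact: pureE|exact: noisyE].
have sE1 i : 2 * fine (outcome_probability E (pure_qubit i) S) -
    fine (outcome_probability E (noisy_qubit i) S) =
    2 * p i - ((1 - eta) * p i + eta * (a + dd - p i)).
  by congr (_ * _ - _); [exact: pureE|exact: noisyE].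
rewrite (eq_bigr _ (fun i _ => sE (c i) i)) (eq_bigr _ (fun i _ => sE1 i)) tE.
(* The reference measure of [S] is half of [a + dd], whence [6144 = 2 * 3072]. *)
rewrite (_ : K * ((a + dd) / 2) =
  3072 * (eta * n.+1%:R * (1 + ln n.+1%:R)) ^+ 2 * (a + dd)); last first.
  by rewrite /K; field.
apply: lattice_chi2_le => // [i|]; last by case/andP: eta01 => -> _.
(* [p i <= a + dd] because the form is nonnegative at the orthogonal vector. *)
have n0 := qubit_sqnorm_gt0 (lattice_coord i.1) (lattice_coord i.2).
by rewrite /= ler_pdivrMr // [leRHS]mulrC -subr_ge0; exact: coq0.
Qed.

End QubitFamily.

Lemma decides_count_ge (R : realType) d (eps : R) n m (a : algorithm R d.+2 n m)
    (side : bool) : 0 < eps -> eps < 1 -> decides a eps ->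
  1 / 1000 ^+ 2 / (eps ^+ 2 * (1 + ln eps^-1) ^+ 2) <= (if side then n else m)%:R.
Proof.
move=> eps0 eps1 dec; set N := (if side then n else m).
have eps01 : 0 <= eps <= 1 by rewrite !ltW.
pose eta := 1 - (1 - eps) ^+ 2.
have eta01 : 0 <= eta <= 1 by rewrite /eta; nra.
pose l := ln eps^-1.
have l0 : 0 <= l by rewrite ln_ge0 // invf_ge1 // ltW.
have fid M (i : 'I_M.+1 * 'I_M.+1) :
    fidelity (pure_qubit R d i) (noisy_qubit d eta01 i) <= (1 - eps)%:C /\
    fidelity (noisy_qubit d eta01 i) (pure_qubit R d i) <= (1 - eps)%:C.
  by have [f1 f2] := mixed_fidelity d (lattice_coord R i.1) (lattice_coord R i.2) eps01;
    split; [rewrite f2|rewrite f1].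
have N0 : (0 < N)%N.
  rewrite lt0n; apply/negP => /eqP Nz.
  (* Without copies there is no POVM to bound, so [K = 0] is allowed and the one-point lattice gives
     [3 / 10 <= 0]. *)
  have := @decides_family_le _ _ _ _ a eps side _ _ _ 0 dec (fid 0).
  rewrite -/N Nz ltnn mul0r card_prod !card_ord => /(_ (fun h => match notF h with end)).
  by lra.
have N1 : 1 <= N%:R :> R by rewrite ler1n.
rewrite ler_pdivrMr; last by rewrite mulr_gt0 ?exprn_gt0 // ltr_wpDr.
(* For [eps > 1 / 4] a single copy already exceeds the claimed bound; otherwise
   [eta <= 1 - (3 / 4)^2 = 7 / 16]. *)
have [eps4|eps4] := ltP (1 / 4) eps.
  have : 1 / 16 <= eps ^+ 2 * (1 + l) ^+ 2 by rewrite -exprMn; nra.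
  rewrite -/l; nra.
have eta_le : eta <= 7 / 16 by rewrite /eta; nra.
have eta_ge : eps <= eta by rewrite /eta; nra.
have eta2 : eta <= 2 * eps by rewrite /eta; nra.
(* The side [M + 1] exceeds [1 / eps], so [eta (M + 1)^2 >= 1], yet is at most [2 / eps], so its
   logarithm is at most [1 + l]. *)
pose M := Num.truncn eps^-1.
have epsV : 1 <= eps^-1 by rewrite invf_ge1 // ltW.
have /andP[Mle Mgt] : M%:R <= eps^-1 < M.+1%:R.
  by apply: truncn_itv; rewrite invr_ge0 ltW.
have epsM : 1 <= eps * M.+1%:R by rewrite mulrC -ler_pdivrMr // div1r ltW.
have M1 : 1 <= M.+1%:R :> R by rewrite ler1n.
have etaM : 1 <= eta * M.+1%:R ^+ 2 by nra.
have lnM : 1 + ln M.+1%:R <= 2 * (1 + l).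
  have : ln (M.+1%:R : R) <= ln (2 * eps^-1).
    rewrite ler_ln ?posrE ?ltr0n ?mulr_gt0 ?invr_gt0 // -natr1; lra.
  rewrite lnM ?posrE ?invr_gt0 // -/l.
  have := @le_ln1Dx R 1; rewrite (_ : 1 + 1 = 2) // => /(_ _); lra.
have lnM0 : 0 <= ln (M.+1%:R : R) by rewrite ln_ge0.
have := @decides_family_le _ _ _ _ a eps side _ _ _ _ dec (fid M)
  (fun _ _ _ E => povm_chi2_bound eta01 E eta_le etaM).
rewrite card_prod card_ord natrM -/N.
set b := M.+1%:R : R; set L := 1 + ln b.
have b2 : 0 < b * b by rewrite mulr_gt0 // ltr0n.
(* The number of lattice points stands on both sides and cancels. *)
have -> : N%:R * (6144 * (eta * b * L) ^+ 2) = b * b * (N%:R * (6144 * (eta * L) ^+ 2)).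
  by ring.
rewrite ler_pM2l // => h.
have : (eta * L) ^+ 2 <= (2 * eps * (2 * (1 + l))) ^+ 2.
  have /andP[eta0 _] := eta01.
  have L0 : 0 <= L by exact: addr_ge0.
  have etaL0 := mulr_ge0 eta0 L0.
  have etaL := ler_pM eta0 L0 eta2 lnM.
  by rewrite ler_pXn2r ?nnegrE // (le_trans etaL0).
rewrite (_ : (2 * eps * (2 * (1 + l))) ^+ 2 = 16 * (eps ^+ 2 * (1 + l) ^+ 2)); last by ring.
(* Numerically, [16 * 6144 / (3 / 10) = 327680 <= 1000^2]. *)
move=> h2; have := ler_wpM2l (ler0n R N) h2; rewrite -/l; lra.
Qed.

Theorem theorem1p4 (R : realType) :
  exists (c : R) (k : nat), 0 < c /\
    forall (d : nat) (eps : R), (2 <= d)%N -> 0 < eps -> eps < 1 ->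
    forall (n m : nat) (a : algorithm R d n m), decides a eps ->
      c / (eps ^+ 2 * (1 + ln eps^-1) ^+ k) <= n%:R /\
      c / (eps ^+ 2 * (1 + ln eps^-1) ^+ k) <= m%:R.
Proof.
exists (1 / 1000 ^+ 2), 2%N; split; first by rewrite divr_gt0 ?exprn_gt0 ?ltr0n.
move=> [|[|d]] // eps _ eps0 eps1 n m a dec; split.
  exact: (decides_count_ge true eps0 eps1 dec).
exact: (decides_count_ge false eps0 eps1 dec).
Qed.
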